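(* Every contractible space is an object of $\mathbf{Fan}$. Consequently, if $\mathbf{Cntr}$ is the category of contractible spaces, then $\mathscr{H}(\mathbf{Cntr})=\mathbf{Fan}$.
   Context: $\mathbf{Top}_0$ is the category of path-connected spaces and continuous maps. For a full subcategory $\mathcal{C}\subseteq\mathbf{Top}_0$, the coreflective hull $\mathscr{H}(\mathcal{C})$ is the full subcategory of $\mathbf{Top}_0$ consisting of all path-connected spaces which are a quotient of a topological sum of objects of $\mathcal{C}$. Let $(J,\leq)$ be a directed set and $K=J\cup\{\infty\}$ be obtained by adding one maximal point $\infty$. Give $K$ the topology generated by the basis sets $\{k\}$ and $V_k=\{\infty\}\cup\{j\in J : j>k\}$ for $k\in J$. The directed arc-fan over $J$ is the cone $F(J)=(K\times[0,1])/(K\times\{0\})$ with the quotient topology. $\mathcal{F}$ is the full subcategory of $\mathbf{Top}_0$ whose objects are the closed unit disk $D^2$ and the directed arc-fans $F(J)$ for all directed sets $J$, and $\mathbf{Fan}=\mathscr{H}(\mathcal{F})$. *)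

(* Defs.v *)
From HB Require Import structures.
From mathcomp Require Import all_boot all_order all_algebra generic_quotient.
From mathcomp Require Import all_classical all_reals topology homotopy.
From mathcomp Require Import normedtype.

Set Implicit Arguments.
Unset Strict Implicit.
Unset Printing Implicit Defensive.

Import Order.TTheory GRing.Theory Num.Theory.
Import numFieldNormedType.Exports.

Local Open Scope classical_set_scope.
Local Open Scope ring_scope.
Local Open Scope quotient_scope.

Definition unit_itv (R : realType) : Type := set_type [set` `[0 : R, 1]].

Section unit_itv.
Context {R : realType}.

HB.instance Definition _ :=
  Topological.copy (unit_itv R) (set_type [set` `[0 : R, 1]]).

Let zero_itv : 0 \in [set` `[0 : R, 1]].
Proof. by rewrite inE /= in_itv /= lexx ler01. Qed.

Let one_itv : 1 \in [set` `[0 : R, 1]].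
Proof. by rewrite inE /= in_itv /= lexx ler01. Qed.

Definition itv_zero : unit_itv R := exist _ 0 zero_itv.
Definition itv_one : unit_itv R := exist _ 1 one_itv.

Let itv_zero_one : itv_zero != itv_one.
Proof. by rewrite -val_eqE /= eq_sym oner_neq0. Qed.

HB.instance Definition _ := isBiPointed.Build (unit_itv R) itv_zero_one.

End unit_itv.

(* The empty space is not path-connected. *)
Definition path_connected (R : realType) (X : topologicalType) : Prop :=
  [set: X] !=set0 /\
  forall x y : X, $| {path (unit_itv R) from x to y in X} |.

Definition contractible (R : realType) (X : topologicalType) : Prop :=
  exists (x0 : X) (H : X * unit_itv R -> X),
    [/\ continuous H, forall x, H (x, zero) = x & forall x, H (x, one) = x0].

Definition quotient_map (X Y : topologicalType) (q : X -> Y) : Prop :=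
  set_surj setT setT q /\ forall U : set Y, open U <-> open (q @^-1` U).

(* A full subcategory of the category of spaces is given by its class of
   objects. *)
Definition full_subcategory := topologicalType -> Prop.

Definition coreflective_hull (R : realType) (C : full_subcategory) :
    full_subcategory := fun X =>
  path_connected R X /\
  exists (I : choiceType) (A : I -> topologicalType) (q : {i : I & A i} -> X),
    (forall i, C (A i)) /\ quotient_map q.

Definition directed_set d (J : preorderType d) : Prop :=
  [set: J] !=set0 /\ forall i j : J, exists k : J, (i <= k)%O /\ (j <= k)%O.

(* None is the added maximal point; Some k is the point k of J. *)
Definition with_infty d (J : preorderType d) : Type := option J.

Section with_infty.
Context {d : Order.disp_t} {J : preorderType d}.

(* In a preorder, k < j means k <= j and not j <= k. *)
Definition tail_nbhd (k : J) : set (with_infty J) :=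
  [set x | if x is Some j then (k < j)%O else True].

(* A basis when J is directed; only the generated topology is used below. *)
Definition directed_basis : set (set (with_infty J)) :=
  [set U | exists k : J, U = [set Some k] \/ U = tail_nbhd k].

HB.instance Definition _ := Choice.copy (with_infty J) (option J).
HB.instance Definition _ :=
  isSubBaseTopological.Build (with_infty J) directed_basis id.

End with_infty.

Section cone.
Context (R : realType) (X : topologicalType).

Let cone_rel' (a b : X * unit_itv R) : bool :=
  (a == b) || ((a.2 == zero) && (b.2 == zero)).

Let cone_rel_refl : reflexive cone_rel'.
Proof. by move=> a; rewrite /cone_rel' eqxx. Qed.

Let cone_rel_sym : symmetric cone_rel'.
Proof. by move=> a b; rewrite /cone_rel' eq_sym andbC. Qed.

Let cone_rel_trans : transitive cone_rel'.
Proof.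
move=> b a c /predU1P[->//|/andP[a0 b0]] /predU1P[<-|/andP[_ c0]].
  by rewrite /cone_rel' a0 b0 orbT.
by rewrite /cone_rel' a0 c0 orbT.
Qed.

Definition cone_rel := EquivRel _ cone_rel_refl cone_rel_sym cone_rel_trans.

Definition cone : Type := {eq_quot cone_rel}.

HB.instance Definition _ :=
  Topological.copy cone (quotient_topology {eq_quot cone_rel}).
HB.instance Definition _ := Quotient.copy cone {eq_quot cone_rel}.

End cone.

Definition arc_fan (R : realType) d (J : preorderType d) : Type :=
  cone R (with_infty J).

HB.instance Definition _ (R : realType) d (J : preorderType d) :=
  Topological.copy (arc_fan R J) (cone R (with_infty J)).

Definition closed_disk (R : realType) : Type :=
  set_type [set z : R * R | z.1 ^+ 2 + z.2 ^+ 2 <= 1].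

HB.instance Definition _ (R : realType) :=
  Topological.copy (closed_disk R)
    (set_type [set z : R * R | z.1 ^+ 2 + z.2 ^+ 2 <= 1]).

Inductive fan_generator (R : realType) : full_subcategory :=
| fan_generator_disk : fan_generator R (closed_disk R)
| fan_generator_arc_fan d (J : preorderType d) :
    directed_set J -> fan_generator R (arc_fan R J).

Definition Fan (R : realType) : full_subcategory :=
  coreflective_hull R (fan_generator R).

Definition Cntr (R : realType) : full_subcategory := contractible R.

(* Main.v *)
(* A non-open set U of a contractible space X is detected by one arc-fan: if x
   in U is not interior, choose a net x_A in A \ U converging to x, indexed by
   the neighbourhoods A of x.  It is a continuous map from K = J + {oo} to X,
   and composing with a contraction of X makes it the restriction to K x {1} of
   a map on the cone over K; the preimage of U under that map is not open.
   Hence X is a quotient of a sum of arc-fans.  Conversely the disk and all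
   cones are contractible, and quotients of sums of spaces compose. *)
From HB Require Import structures.
Require Import Defs.
From mathcomp Require Import all_boot all_order all_algebra.
From mathcomp Require Import generic_quotient finmap.
From mathcomp Require Import all_classical all_reals topology.
From mathcomp Require Import homotopy normedtype lra.

Set Implicit Arguments.
Unset Strict Implicit.
Unset Printing Implicit Defensive.

Import Order.TTheory GRing.Theory Num.Theory.
Import numFieldNormedType.Exports.

Local Open Scope classical_set_scope.
Local Open Scope ring_scope.
Local Open Scope quotient_scope.

(** * Quotients of topological sums, tested one map at a time *)

Definition sum_quotient (C : full_subcategory) (X : topologicalType) : Prop :=
  exists (I : choiceType) (A : I -> topologicalType) (q : {i : I & A i} -> X),
    (forall i, C (A i)) /\ quotient_map q.

Lemma quotient_map_continuous (X Y : topologicalType) (q : X -> Y) :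
  quotient_map q -> continuous q.
Proof. by move=> [_ qE]; apply/continuousP => U /qE. Qed.

(** A set is open in a sum exactly when its trace on every summand is. So a presentation amounts to
    continuous maps from objects of [C] that reach each point and detect each non-open set; points
    and non-open sets themselves index the sum built for the converse. *)
Lemma sum_quotientP (C : full_subcategory) (X : topologicalType) :
  sum_quotient C X <->
  forall s : X + set_type [set U : set X | ~ open U],
  exists (B : topologicalType) (f : B -> X), [/\ C B, continuous f &
    match s with
    | inl x => range f x
    | inr U => ~ open (f @^-1` \val U)
    end].
Proof.
split.
  move=> [J [A [q [CA qq]]]]; have [q_surj qE] := qq.
  have cq i : continuous (q \o existT A i).
    move=> x; apply: continuous_comp; first exact: existT_continuous.
    exact: quotient_map_continuous.
  case=> [x|[U mU]].
    by have [[i a] _ <-] := q_surj x I; exists (A i), (q \o existT A i).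
  have /= nU := set_mem mU.
  have /existsNP[i nUi] :
      ~ forall i, open ((q \o existT A i) @^-1` U).
    by move=> oU; apply/nU/qE/sigT_openP.
  by exists (A i), (q \o existT A i).
move=> CX.
pose B s := projT1 (cid (CX s)).
pose f s : B s -> X := projT1 (cid (projT2 (cid (CX s)))).
have fP s : [/\ C (B s), continuous (f s) & match s with
    | inl x => range (f s) x
    | inr U => ~ open (f s @^-1` \val U)
    end] := projT2 (cid (projT2 (cid (CX s)))).
exists (X + set_type [set U : set X | ~ open U])%type, B,
  (fun p => f (projT1 p) (projT2 p)).
split=> [s|]; first by have [] := fP s.
split.
  by move=> x _; have [_ _ [b _ <-]] := fP (inl x); exists (existT _ (inl x) b).
move=> U; split=> [|/sigT_openP oU].
  by move: U; apply/continuousP/sigT_continuous => s; have [] := fP s.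
apply: contrapT => nU.
have [_ _] := fP (inr (exist _ U (mem_set nU))).
by apply; exact: (oU (inr (exist _ U (mem_set nU)))).
Qed.

(** With the criterion above, witnesses compose: the map from [B] pulls a point or a non-open set
    back to [B], where [C] supplies the next witness. This avoids re-indexing a sum of sums. *)
Lemma sum_quotient_trans (C D : full_subcategory) (X : topologicalType) :
  (forall B, D B -> sum_quotient C B) -> sum_quotient D X -> sum_quotient C X.
Proof.
move=> DC /sum_quotientP DX; apply/sum_quotientP => s.
have [B [f [DB cf sP]]] := DX s.
have /sum_quotientP CB := DC _ DB.
case: s sP => [x [b _ <-]|U nU].
  have [E [g [CE cg [e _ <-]]]] := CB (inl b).
  exists E, (f \o g); split=> //=; last by exists e.
  by move=> z; apply: continuous_comp; [exact: cg|exact: cf].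
have [E [g [CE cg nV]]] := CB (inr (exist _ (f @^-1` \val U) (mem_set nU))).
exists E, (f \o g); split => // z.
by apply: continuous_comp; [exact: cg|exact: cf].
Qed.

Lemma sum_quotient_sub (C D : full_subcategory) (X : topologicalType) :
  (forall B, C B -> D B) -> sum_quotient C X -> sum_quotient D X.
Proof.
by move=> CD [I [A [q [CA qq]]]]; exists I, A, q; split => // i; exact/CD.
Qed.

(** * The unit interval as a retract of the line *)

Section unit_interval.
Context {R : realType}.
Implicit Types s t : unit_itv R.

Lemma unit_itvP t : 0 <= \val t <= 1.
Proof. by case: t => r /=; rewrite inE /= in_itv. Qed.

Lemma val_itv_continuous : continuous (\val : unit_itv R -> R).
Proof. exact: initial_continuous. Qed.

Let clamp_subproof (r : R) :
  Num.max 0 (Num.min 1 r) \in [set` `[0 : R, 1]].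
Proof. by rewrite inE /= in_itv /= le_max lexx ge_max ler01 ge_min lexx. Qed.

(** The retraction of the line onto the interval, which lets homotopy parameters be given by real
    formulas. *)
Definition clamp (r : R) : unit_itv R :=
  exist (fun x => x \in [set` `[0, 1]]) _ (clamp_subproof r).

Lemma continuous_itv (T : topologicalType) (f : T -> unit_itv R) :
  continuous (\val \o f : T -> R) -> continuous f.
Proof. exact: continuous_comp_initial. Qed.

Lemma clamp_continuous : continuous clamp.
Proof.
apply: continuous_itv; apply: max_fun_continuous; first exact: cst_continuous.
apply: min_fun_continuous; first exact: cst_continuous.
by move=> r; exact: cvg_id.
Qed.

Lemma val_clamp (r : R) : 0 <= r <= 1 -> \val (clamp r) = r.
Proof. by case/andP=> r0 r1 /=; rewrite min_r// max_r. Qed.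

Lemma valK_clamp : cancel (\val : unit_itv R -> R) clamp.
Proof. by move=> t; apply: val_inj; rewrite val_clamp// unit_itvP. Qed.

Lemma clamp0 (r : R) : r <= 0 -> clamp r = zero.
Proof.
move=> r0; apply: val_inj => /=; rewrite max_l//.
by rewrite ge_min r0 orbT.
Qed.

Lemma clamp1 (r : R) : 1 <= r -> clamp r = one.
Proof. by move=> r1; apply: val_inj => /=; rewrite min_l// max_r. Qed.

Lemma unit_itv_compact : compact [set: unit_itv R].
Proof.
have -> : [set: unit_itv R] = clamp @` `[0, 1].
  apply/esym/seteqP; split=> // t _; exists (\val t); last exact: valK_clamp.
  by rewrite /= in_itv /= unit_itvP.
apply: continuous_compact; last exact: segment_compact.
exact/continuous_subspaceT/clamp_continuous.
Qed.

Lemma unit_itv_hausdorff : hausdorff_space (unit_itv R).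
Proof.
move=> s t st; apply: val_inj; apply: Rhausdorff => A B.
move=> /val_itv_continuous nA /val_itv_continuous nB.
by have [u [Au Bu]] := st _ _ nA nB; exists (\val u).
Qed.

Lemma unit_itv_locally_compact : locally_compact [set: unit_itv R].
Proof.
move=> t _; exists setT; first exact: filterT.
by split; [exact: unit_itv_compact|exact: closedT].
Qed.

End unit_interval.

Lemma comp_continuous (X Y Z : topologicalType) (f : X -> Y) (g : Y -> Z) :
  continuous g -> continuous f -> continuous (fun x => g (f x)).
Proof. by move=> cg cf x; apply: continuous_comp; [exact: cf|exact: cg]. Qed.

Lemma pair_continuous (X Y Z : topologicalType) (f : X -> Y) (g : X -> Z) :
  continuous f -> continuous g -> continuous (fun x => (f x, g x)).
Proof. by move=> cf cg x; apply: cvg_pair; [exact: cf|exact: cg]. Qed.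

Lemma fst_continuous (X Y : topologicalType) : continuous (@fst X Y).
Proof. by move=> x; exact: cvg_fst. Qed.

Lemma snd_continuous (X Y : topologicalType) : continuous (@snd X Y).
Proof. by move=> x; exact: cvg_snd. Qed.

Lemma mulr_continuous (R : realType) (X : topologicalType) (f g : X -> R) :
  continuous f -> continuous g -> continuous (fun x => f x * g x).
Proof. by move=> cf cg x; apply: cvgM; [exact: cf|exact: cg]. Qed.

Lemma val_compl_continuous (R : realType) :
  continuous (fun t : unit_itv R => 1 - \val t).
Proof.
have c : continuous (fun r : R => 1 - r).
  by move=> r; apply: cvgB; [exact: cvg_cst|exact: cvg_id].
exact: comp_continuous c (@val_itv_continuous R).
Qed.

(** * Cones: universal property and contraction *)

Section cone_theory.
Context {R : realType} {X : topologicalType}.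

Definition to_cone (p : X * unit_itv R) : cone R X := \pi_(cone R X) p.

Lemma to_cone_surj (c : cone R X) : exists p, to_cone p = c.
Proof. by exists (repr c); exact: reprK. Qed.

Lemma to_cone_continuous : continuous to_cone.
Proof. exact: pi_continuous. Qed.

Lemma cone_continuous (Z : topologicalType) (f : cone R X -> Z) :
  continuous (f \o to_cone) -> continuous f.
Proof. by move=> cf; apply/quotient_continuous. Qed.

Lemma to_cone_apex (x y : X) : to_cone (x, zero) = to_cone (y, zero).
Proof. by apply/eqmodP; rewrite /= eqxx orbT. Qed.

(** The chosen representative of the class of [p] is either [p] itself or, like [p], at height zero,
    where [g] takes a single value. *)
Lemma cone_lift (Z : topologicalType) (g : X * unit_itv R -> Z) :
  continuous g -> (forall x y, g (x, zero) = g (y, zero)) ->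
  exists2 h : cone R X -> Z, continuous h & forall p, h (to_cone p) = g p.
Proof.
move=> cg g0.
have gE p : g (repr (to_cone p)) = g p.
  have /eqmodP : to_cone (repr (to_cone p)) = to_cone p by exact: reprK.
  case/predU1P => [->//|/andP[]].
  by case: p (repr _) => [x s] [y t] /= /eqP-> /eqP->.
exists (g \o repr) => //; apply: cone_continuous.
by rewrite (_ : _ \o _ = g)//; apply/funext => p; exact: gE.
Qed.

Lemma cone_contractible : [set: X] !=set0 -> contractible R (cone R X).
Proof.
move=> [x0 _].
(* Scaling the height by [1 - t] slides the cone into its apex. *)
pose G (p : (X * unit_itv R) * unit_itv R) :=
  to_cone (p.1.1, clamp (\val p.1.2 * (1 - \val p.2))).
have cG : continuous G.
  apply: (comp_continuous to_cone_continuous); apply: pair_continuous.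
    exact: (comp_continuous (@fst_continuous _ _) (@fst_continuous _ _)).
  apply: (comp_continuous (@clamp_continuous R)); apply: mulr_continuous.
    apply: (comp_continuous (@val_itv_continuous R)).
    exact: (comp_continuous (@snd_continuous _ _) (@fst_continuous _ _)).
  exact: (comp_continuous (@val_compl_continuous R) (@snd_continuous _ _)).
(* cone x I is not visibly a quotient of X x I x I, so the homotopy is curried,
   descended to the cone, and uncurried since I is locally compact. *)
have [cG1 cG2] := continuous_curry cG.
have [x y|h ch hE] := @cone_lift {compact-open, unit_itv R -> cone R X} _ cG1.
  apply/funext => t; rewrite /curry /G /=.
  by rewrite mul0r clamp0//; exact: to_cone_apex.
exists (to_cone (x0, zero)), (uncurry h); split.
- apply: continuous_uncurry => //.
  + exact: unit_itv_locally_compact.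
  + exact: unit_itv_hausdorff.
  + by move=> c; have [p <-] := to_cone_surj c; rewrite hE; exact: cG2.
- move=> c; have [[x s] <-] := to_cone_surj c.
  by rewrite /uncurry hE /curry /G /= subr0 mulr1 valK_clamp.
- move=> c; have [[x s] <-] := to_cone_surj c.
  rewrite /uncurry hE /curry /G /= subrr mulr0 clamp0//.
  exact: to_cone_apex.
Qed.

End cone_theory.

(** * Contraction of the disk; paths in contractible spaces *)

Lemma closed_disk_contractible (R : realType) :
  contractible R (closed_disk R).
Proof.
have H_subproof (p : closed_disk R * unit_itv R) :
    ((1 - \val p.2) * (\val p.1).1, (1 - \val p.2) * (\val p.1).2) \in
      [set z : R * R | z.1 ^+ 2 + z.2 ^+ 2 <= 1].
  case: p => -[[x y] xy] t /=; move: xy; rewrite !inE /= => xy.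
  have /andP[t0 t1] := unit_itvP t.
  (* The squared norm is multiplied by [(1 - t) ^+ 2], which is at most 1. *)
  rewrite !exprMn -mulrDr mulr_ile1 ?addr_ge0 ?sqr_ge0//.
  by rewrite exprn_ile1 ?subr_ge0 ?gerBl.
have disk0 : (0, 0) \in [set z : R * R | z.1 ^+ 2 + z.2 ^+ 2 <= 1].
  by rewrite inE /= expr0n addr0 ler01.
exists (exist (fun z => z \in _) _ disk0).
exists (fun p => exist (fun z => z \in _) _ (H_subproof p)); split.
- apply: continuous_comp_initial.
  have c1 : continuous
      (fun p : closed_disk R * unit_itv R => 1 - \val p.2).
    exact: comp_continuous (@val_compl_continuous R) (@snd_continuous _ _).
  have c2 : continuous (fun p : closed_disk R * unit_itv R => \val p.1).
    exact: comp_continuous (@initial_continuous _ _ _) (@fst_continuous _ _).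
  apply: pair_continuous; apply: mulr_continuous => //.
  + exact: comp_continuous (@fst_continuous _ _) c2.
  + exact: comp_continuous (@snd_continuous _ _) c2.
- by move=> z; apply: val_inj; rewrite /= subr0 !mul1r -surjective_pairing.
- by move=> z; apply: val_inj; rewrite /= subrr !mul0r.
Qed.

(** The contraction carries both [x] and [y] to [x0]; the path follows the track of [x], then that
    of [y] backwards. *)
Lemma contractible_path_connected (R : realType) (X : topologicalType) :
  contractible R X -> path_connected R X.
Proof.
move=> [x0 [H [cH H0 H1]]]; split; first by exists x0.
move=> x y.
pose f (a : X) (c : R -> R) (t : unit_itv R) := H (a, clamp (c (\val t))).
have cf a c : continuous c -> continuous (f a c).
  move=> cc; apply: (comp_continuous cH); apply: pair_continuous.
    exact: cst_continuous.
  apply: (comp_continuous (@clamp_continuous R)).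
  exact: comp_continuous cc (@val_itv_continuous R).
(* The tracks are run at double speed, at parameters [2t] and [2 - 2t]; both are at [x0] when [t] is
   one half. *)
pose f1 := f x (fun r => r + r); pose f2 := f y (fun r => (1 - r) + (1 - r)).
have cf1 : continuous f1.
  by apply: cf => r; apply: cvgD; exact: cvg_id.
have cf2 : continuous f2.
  by apply: cf => r; apply: cvgD; apply: cvgB;
    by [exact: cvg_cst|exact: cvg_id].
pose g (t : unit_itv R) := if \val t <= 2^-1 then f1 t else f2 t.
have gE2 t : 2^-1 <= \val t -> g t = f2 t.
  rewrite le_eqVlt => /predU1P[t2|].
    by rewrite /g /f1 /f2 /f -t2 lexx !clamp1 ?H1//; lra.
  by rewrite ltNge /g => /negbTE->.
have cg : continuous g.
  (* Pasting: the two halves of the interval are closed, so a closed set has closed preimage. *)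
  apply/continuous_closedP => C cC.
  have -> : g @^-1` C =
      (\val @^-1` [set r | r <= 2^-1] `&` f1 @^-1` C) `|`
      (\val @^-1` [set r | 2^-1 <= r] `&` f2 @^-1` C).
    apply/seteqP; split=> t /=.
      have [t2|/ltW t2] := leP (\val t) 2^-1; last by rewrite gE2//; right.
      by rewrite {1}/g t2; left.
    by case=> -[t2]; [rewrite /g t2|rewrite gE2].
  have cv : continuous (\val : unit_itv R -> R) := val_itv_continuous.
  apply: closedU; apply: closedI.
  - exact: (continuous_closedP _).1 cv _ (@closed_le _ _).
  - exact: (continuous_closedP _).1 cf1 _ cC.
  - exact: (continuous_closedP _).1 cv _ (@closed_ge _ _).
  - exact: (continuous_closedP _).1 cf2 _ cC.
have g0 : g zero = x.
  by rewrite /g /= invr_ge0 ler0n /f1 /f /= addr0 clamp0.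
have g1 : g one = y.
  rewrite gE2 /=; last by rewrite invf_le1 ?ler1n.
  by rewrite /f2 /f /= subrr addr0 clamp0.
by apply: squash; exact: (mk_path cg g0 g1).
Qed.

(** * Neighbourhoods of infinity and nets of neighbourhoods *)

Section with_infty_topology.
Context {d : Order.disp_t} {J : preorderType d}.

Lemma directed_basis_open (U : set (with_infty J)) :
  directed_basis U -> open U.
Proof.
move=> bU; exists [set U]; last by rewrite bigcup_set1.
by move=> _ ->; exact: finI_from1.
Qed.

Lemma tail_nbhd_filter :
  directed_set J -> Filter (filter_from [set: J] tail_nbhd).
Proof.
move=> [[j0 _] dirJ]; apply: filter_from_filter; first by exists j0.
move=> i j _ _; have [k [ik jk]] := dirJ i j; exists k => // -[l|//] kl /=.
by split; [exact: le_lt_trans ik kl|exact: le_lt_trans jk kl].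
Qed.

(** Around infinity [U] contains a finite intersection of subbasic sets. None of them is a singleton
    [[set Some k]], which misses infinity, so all are tails, and by directedness a finite
    intersection of tails contains a tail. *)
Lemma open_tail (U : set (with_infty J)) :
  directed_set J -> open U -> U None -> exists k, tail_nbhd k `<=` U.
Proof.
move=> dirJ [D sD <-] [V DV Vinfty].
have [E sE EV] : finI_from (@directed_basis _ J) id V := sD V DV.
change (V None) in Vinfty; rewrite -EV in Vinfty.
have tail_filter := tail_nbhd_filter dirJ.
have [k _ kE] : filter_from [set: J] tail_nbhd
    (\bigcap_(W in [set` E]) W).
  apply: filter_bigI => W WE; have /set_mem[k [Wk|Wk]] := sE W WE.
    by have := Vinfty W WE; rewrite /= Wk.
  by exists k; rewrite // Wk.
by exists k => z /kE Ez; exists V; rewrite // -EV.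
Qed.

End with_infty_topology.

(* The second coordinate makes every index have a strictly larger one, even if
   x has a smallest neighbourhood. *)
Definition nbhs_index (X : topologicalType) (x : X) : Type :=
  (set_type [set A : set X | nbhs x A] * nat)%type.

Section nbhs_index.
Context {X : topologicalType} (x : X).

HB.instance Definition _ := Choice.on (nbhs_index x).

(** Reverse inclusion of neighbourhoods; only the counter has to grow strictly, so the neighbourhood
    may stay the same. *)
Let lt (i j : nbhs_index x) : bool :=
  `[<\val j.1 `<=` \val i.1 >] && (i.2 < j.2)%N.

Let lt_irr : irreflexive lt.
Proof. by move=> i; rewrite /lt ltnn andbF. Qed.

Let lt_trans : transitive lt.
Proof.
move=> j i k /andP[/asboolP ij ltij] /andP[/asboolP jk ltjk].
by rewrite /lt (ltn_trans ltij ltjk) andbT; apply/asboolP => z /jk /ij.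
Qed.

HB.instance Definition _ :=
  Order.Lt_isPreorder.Build (Order.Disp tt tt) (nbhs_index x) lt_irr lt_trans.

Lemma nbhs_index_lt (i j : nbhs_index x) :
  (i < j)%O = `[<\val j.1 `<=` \val i.1 >] && (i.2 < j.2)%N.
Proof. by []. Qed.

Definition Nbhs_index (A : set X) (n : nat) (nA : nbhs x A) : nbhs_index x :=
  (exist _ A (mem_set nA), n).

Lemma nbhs_indexP (i : nbhs_index x) : nbhs x (\val i.1).
Proof. by case: i => -[A mA] n; exact: (set_mem mA). Qed.

Lemma nbhs_index_directed : directed_set (nbhs_index x).
Proof.
split; first by exists (Nbhs_index 0 filterT).
move=> i j.
(* The successor makes the bound strict over both indices, so [<=] follows from [<]. *)
exists (Nbhs_index (maxn i.2 j.2).+1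
  (filterI (nbhs_indexP i) (nbhs_indexP j))).
split; apply/ltW; rewrite nbhs_index_lt /= ltnS ?leq_maxl ?leq_maxr andbT.
  by apply/asboolP => z [].
by apply/asboolP => z [].
Qed.

(** Points other than infinity are isolated. At infinity, every index beyond [(W, 0)] carries a
    subset of [W], so the net stays in [W]. *)
Lemma nbhs_index_net_continuous (g : with_infty (nbhs_index x) -> X) :
  g None = x -> (forall i : nbhs_index x, (\val i.1) (g (Some i))) ->
  continuous g.
Proof.
move=> gx gi; case=> [i|] W.
  move=> /nbhs_singleton Wi; rewrite nbhsE; exists [set Some i].
    split => //; apply: directed_basis_open; by exists i; left.
  by move=> _ ->.
rewrite gx => nW; rewrite nbhsE; exists (tail_nbhd (Nbhs_index 0 nW)).
  by split => //; apply: directed_basis_open; exists (Nbhs_index 0 nW); right.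
case=> [i|_]; last by rewrite /= gx; exact: nbhs_singleton.
rewrite /tail_nbhd /= nbhs_index_lt => /andP[/asboolP iW _].
exact/iW/gi.
Qed.

End nbhs_index.

(** * Contractible spaces as quotients of sums of arc-fans *)

(** The contraction is run in reverse along the height: at height zero everything sits at [x0], so
    the map descends to the cone, and at height one it is [g]. *)
Lemma contractible_cone_extension (R : realType) (K X : topologicalType)
    (g : K -> X) :
  contractible R X -> continuous g ->
  exists2 f : cone R K -> X, continuous f &
    forall k, f (to_cone (k, one)) = g k.
Proof.
move=> [x0 [H [cH H0 H1]]] cg.
have [|k l|f cf fE] :=
  @cone_lift R K X (fun p => H (g p.1, clamp (1 - \val p.2))).
- apply: (comp_continuous cH); apply: pair_continuous.
    exact: (comp_continuous cg (@fst_continuous _ _)).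
  apply: (comp_continuous (@clamp_continuous R)).
  exact: (comp_continuous (@val_compl_continuous R) (@snd_continuous _ _)).
- by rewrite /= subr0 clamp1 ?lexx// !H1.
- by exists f => // k; rewrite fE /= subrr clamp0 ?lexx// H0.
Qed.

Lemma contractible_sum_quotient (R : realType) (X : topologicalType) :
  contractible R X -> sum_quotient (fan_generator R) X.
Proof.
move=> ctrX; apply/sum_quotientP.
have fan_net (x : X) (g : with_infty (nbhs_index x) -> X) : continuous g ->
    exists2 f : arc_fan R (nbhs_index x) -> X, continuous f &
      forall k, f (to_cone (k, one)) = g k.
  exact: contractible_cone_extension.
case=> [x|[U mU]].
  have [|f cf fE] := fan_net x (fun=> x); first exact: cst_continuous.
  exists (arc_fan R (nbhs_index x)), f; split => //.
    by apply: fan_generator_arc_fan; exact: nbhs_index_directed.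
  by exists (to_cone (None : with_infty (nbhs_index x), one)).
have /= := set_mem mU; rewrite openE => /existsNP[x /not_implyP[Ux nU]].
(* As [U] is not a neighbourhood of [x], no neighbourhood of [x] is contained in [U]. *)
have /choice[h hP] (i : nbhs_index x) : exists y, (\val i.1) y /\ ~ U y.
  apply: contrapT => /forallNP iU; apply: nU.
  apply: filterS (nbhs_indexP i) => y iy.
  by apply: contrapT => nUy; apply: (iU y).
pose g (k : with_infty (nbhs_index x)) := if k is Some i then h i else x.
have cg : continuous g.
  by apply: nbhs_index_net_continuous => // i; have [] := hP i.
have [f cf fE] := fan_net x g cg.
exists (arc_fan R (nbhs_index x)), f; split => //.
  by apply: fan_generator_arc_fan; exact: nbhs_index_directed.
move=> ofU.
(* The embedding of [K] at height one pulls the preimage of [U] in the fan back to its preimage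
   under the net. *)
have ogU : open (g @^-1` U).
  have -> : g @^-1` U =
      (fun k => to_cone (k, one : unit_itv R)) @^-1` (f @^-1` U).
    by apply/funext => k /=; rewrite fE.
  apply: (continuousP _).1 ofU.
  apply: (comp_continuous to_cone_continuous); apply: pair_continuous.
    by move=> k; exact: cvg_id.
  exact: cst_continuous.
have [[A n] AU] := open_tail (nbhs_index_directed x) ogU Ux.
(* Raising the counter gives a point of the tail beyond [(A, n)]; the net sends it outside [U],
   although the tail is mapped into [U]. *)
have lt_top : ((A, n) < (A, n.+1) :> nbhs_index x)%O.
  by rewrite nbhs_index_lt /= ltnSn andbT; apply/asboolP.
have [_] := hP (A, n.+1); apply; exact: (AU (Some (A, n.+1))).
Qed.

Lemma fan_generator_contractible (R : realType) (B : topologicalType) :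
  fan_generator R B -> contractible R B.
Proof.
case=> [|d J dirJ]; first exact: closed_disk_contractible.
by apply: cone_contractible; exists None.
Qed.

Theorem theorem65 (R : realType) :
  (forall X : topologicalType, contractible R X -> Fan R X) /\
  coreflective_hull R (Cntr R) = Fan R.
Proof.
split.
  move=> X ctrX; split; first exact: contractible_path_connected.
  exact: contractible_sum_quotient.
(* Both hulls ask for path-connectedness, so only the presentations as quotients of sums are
   compared. *)
apply/funext => X; apply/propext; split=> -[pcX hX]; split => //.
  by apply: sum_quotient_trans hX => B; exact: contractible_sum_quotient.
by apply: sum_quotient_sub hX => B; exact: fan_generator_contractible.
Qed.
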